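(* Let $\mathcal{M}=(G,In,Out,V)$ be a linear compartmental model (with a leak in every compartment) such that either $G$ is strongly input-output connected and $|Out|=1$, or $G$ is strongly connected and $|In|=1$. If the image of the coefficient map of $\mathcal{M}$ has dimension $|E|+|In\cup Out|$, then $\mathcal{M}$ is an identifiable path/cycle model.
   Context: A linear compartmental model $(G,In,Out,Leak)$ consists of a finite directed graph $G=(V,E)$ (no self-loops, no repeated edges) and subsets $In,Out,Leak\subseteq V$ (input, output and leak compartments; $In,Out$ nonempty). Each edge $j\to i$ carries an independent parameter $a_{ij}$ and each $i\in Leak$ an independent parameter $a_{0i}$. The compartmental matrix $A$ has $A_{ij}=a_{ij}$ if $j\to i\in E$; $A_{ii}=-a_{0i}-\sum_{k:\,i\to k\in E}a_{ki}$ if $i\in Leak$; $A_{ii}=-\sum_{k:\,i\to k\in E}a_{ki}$ if $i\notin Leak$; all other entries $0$. The model is the system $x'=Ax+u$, $y_i=x_i$ for $i\in Out$, with $u_i\equiv 0$ for $i\notin In$. When $Leak=V$, the diagonal entries $a_{ii}:=A_{ii}$ are algebraically independent and are used as parameters in place of the $a_{0i}$. When every vertex has a directed path to every output (which holds under the hypotheses here), the input-output equation for $j\in Out$ is $\det(\partial I-A)\,y_j=\sum_{i\in In}(-1)^{i+j}\det(\partial I-A)_{ij}\,u_i$, where $\partial=d/dt$ and $(\cdot)_{ij}$ means delete row $i$ and column $j$. The coefficient map $c:\mathbb{R}^{|E|+|Leak|}\to\mathbb{R}^k$ collects all nonzero, nonmonic coefficients (polynomials in the parameters) of these equations over all $j\in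 Out$. A cycle is a closed directed path with no repeated vertices; to a cycle or directed path associate the monomial that is the product of the parameters of its edges. The diagonal entries $a_{ii}$ count as monomial cycles of length 1 (self-cycles). $G$ is strongly input-output connected if it is connected (as an undirected graph) and every edge lies in a cycle or in a directed path from an input vertex to an output vertex. A function $f$ of the parameters is locally identifiable (from $c$) if there is a finitely multivalued function $\Phi$ with $\Phi\circ c=f$ (generically). A model $(G,In,Out,V)$ is an identifiable path/cycle model if all of the independent monomial cycles (including self-cycles) and monomial paths from input to output are locally identifiable and each parameter is contained in such a cycle or path. *)

(* Defs.v *)
From HB Require Import structures.
From mathcomp Require Import all_boot all_order all_algebra.
From mathcomp Require Import ring_quotient.
From mathcomp Require Import mpoly.
From mathcomp Require Import reals.

Set Implicit Arguments.
Unset Strict Implicit.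
Unset Printing Implicit Defensive.

Import GRing.Theory.
Local Open Scope ring_scope.


(** * Models and their graphs *)

(* [edge M j i] is the edge j -> i. *)
Record model (n : nat) := Model {
  edge : rel 'I_n;
  inp : {set 'I_n};
  outp : {set 'I_n};
  leak : {set 'I_n};
  edge_irrefl : irreflexive edge;
  inp_neq0 : inp != set0;
  outp_neq0 : outp != set0
}.

Section Graph.
Variables (n : nat) (M : model n).
Implicit Types (s : seq 'I_n) (a : 'I_n * 'I_n).

Definition num_edges : nat := #|[set a | edge M a.1 a.2]|.

Definition strongly_connected : Prop := forall u v, connect (edge M) u v.

Definition weakly_connected : Prop :=
  forall u v, connect [rel x y | edge M x y || edge M y x] u v.

(* A cycle v_0 -> ... -> v_r -> v_0 is the sequence of its distinct vertices. *)
Definition graph_cycle s : bool :=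
  [&& s != [::], path.cycle (edge M) s & uniq s].

(* The arcs (v_0, v_1), ..., (v_r, v_0); in particular [:: (v, v)] for [:: v]. *)
Definition cycle_arcs s : seq ('I_n * 'I_n) := zip s (rot 1 s).

Definition self_cycle s : bool := size s == 1%N.

(* A directed path v_0 -> ... -> v_r with distinct vertices, v_0 an input and
   v_r an output; r = 0 is allowed when v_0 is both. *)
Definition io_path s : bool :=
  if s is v :: p then
    [&& path (edge M) v p, uniq (v :: p), v \in inp M & last v p \in outp M]
  else false.

Definition path_arcs s : seq ('I_n * 'I_n) := zip s (behead s).

Definition strongly_io_connected : Prop :=
  weakly_connected /\
  forall j i, edge M j i ->
    (exists2 s, graph_cycle s & (j, i) \in cycle_arcs s) \/
    (exists2 s, io_path s & (j, i) \in path_arcs s).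

(** * Parameters *)

(* The parameter a_ij of the edge j -> i is (Some i, j), and the leak parameter
   a_0i is (None, i): [None] is the environment. *)
Definition is_param (q : option 'I_n * 'I_n) : bool :=
  if q.1 is Some i then edge M q.2 i else q.2 \in leak M.

Definition param : finType := {q : option 'I_n * 'I_n | is_param q}.

(* This is |E| + |Leak|. *)
Definition nparam : nat := #|{: param}|.

End Graph.

(** * Krull dimension of the Zariski closure *)

Section Dimension.
Variables (R : realType) (k : nat).

Definition vanishes_on (S : ('I_k -> R) -> Prop) (p : {mpoly R[k]}) : Prop :=
  forall y, S y -> p.@[y] = 0.

(* Chains P_0 < ... < P_l of prime ideals containing the ideal of S, that is,
   chains of prime ideals of the ring of polynomial functions on S. *)
Definition prime_chain (S : ('I_k -> R) -> Prop) (l : nat) : Prop :=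
  exists P : 'I_l.+1 -> {pred {mpoly R[k]}},
    [/\ forall i, idealr_closed (P i) /\ prime_idealr_closed (P i),
        forall i p, vanishes_on S p -> p \in P i
      & forall i j : 'I_l.+1, (i < j)%N ->
          {subset P i <= P j} /\ exists2 p, p \in P j & p \notin P i].

(* For semialgebraic S, such as the image of a polynomial map, this is the
   usual dimension (Bochnak-Coste-Roy, Real Algebraic Geometry, Def. 2.8.1). *)
Definition has_dimension (S : ('I_k -> R) -> Prop) (d : nat) : Prop :=
  prime_chain S d /\ forall l, prime_chain S l -> (l <= d)%N.

End Dimension.

(** * Input-output equations and identifiability *)

Section Identifiability.
Variables (R : realType) (n : nat) (M : model n).

Local Notation pring := {mpoly R[nparam M]}.

(* The parameter a_ts as a variable, and 0 when there is no such parameter. *)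
Definition par (t : option 'I_n) (s : 'I_n) : pring :=
  if insub (t, s) is Some q then 'X_(enum_rank (q : param M)) else 0.

Definition compartmental_matrix : 'M[pring]_n :=
  \matrix_(i, j)
    if i == j then - par None i - \sum_(k | edge M i k) par (Some k) i
    else par (Some i) j.

(* The coefficients of det(dI - A) and of the (-1)^(i+j) det(dI - A)_ij,
   i \in In, as polynomials in d. *)
Definition io_coefs (j : 'I_n) : seq pring :=
  polyseq (char_poly compartmental_matrix) ++
  flatten [seq polyseq (cofactor (char_poly_mx compartmental_matrix) i j)
          | i <- enum (inp M)].

(* No coefficient equals 1 except a leading one, so [c != 1] removes exactly
   the monic ones. *)
Definition coefs : seq pring :=
  [seq c <- flatten [seq io_coefs j | j <- enum (outp M)]
  | (c != 0) && (c != 1)].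

Definition coefficient_map (theta : 'I_(nparam M) -> R) : 'I_(size coefs) -> R :=
  fun l => (coefs`_l).@[theta].

Definition coefficient_image (y : 'I_(size coefs) -> R) : Prop :=
  exists theta, y = coefficient_map theta.

(* Outside of a proper algebraic subset. *)
Definition generically (P : ('I_(nparam M) -> R) -> Prop) : Prop :=
  exists2 g : pring, g != 0 & forall theta, g.@[theta] != 0 -> P theta.

(* [Phi] is finitely multivalued: its values at y are the members of [Phi y]. *)
Definition locally_identifiable (f : ('I_(nparam M) -> R) -> R) : Prop :=
  exists Phi : ('I_(size coefs) -> R) -> seq R,
    generically (fun theta => f theta \in Phi (coefficient_map theta)).

(* The arc (j, i) contributes A_ij: the edge parameter a_ij when j -> i, and
   the diagonal parameter a_ii when i = j. *)
Definition monomial (arcs : seq ('I_n * 'I_n)) : pring :=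
  \prod_(a <- arcs) compartmental_matrix a.2 a.1.

(* The parameters are the a_ij for j -> i and, the leaks being everywhere, the
   a_ii in place of the a_0i. *)
Definition identifiable_path_cycle_model : Prop :=
  [/\ leak M = [set: 'I_n],
      forall s, graph_cycle M s || self_cycle s ->
        locally_identifiable (fun theta => (monomial (cycle_arcs s)).@[theta]),
      forall s, io_path M s ->
        locally_identifiable (fun theta => (monomial (path_arcs s)).@[theta])
    & forall j i, (j == i) || edge M j i ->
        (exists2 s, graph_cycle M s || self_cycle s & (j, i) \in cycle_arcs s)
        \/ (exists2 s, io_path M s & (j, i) \in path_arcs s)].

End Identifiability.

(* Main.v *)
Require Import Defs.
From mathcomp Require Import all_boot all_order all_algebra reals.
From mathcomp Require Import perm ring_quotient boolp mpoly polyrcf zify.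

(** Call a product of entries of the compartmental matrix A balanced if, in the
    multigraph of the corresponding arcs, every vertex which is neither an input
    nor an output has as many incoming as outgoing arcs.  Equivalently, it is
    invariant under the torus that rescales the states x_i by nonzero factors
    d_i, with d_i = 1 for i in In or Out.  The monomials of cycles and of
    input-output paths are balanced, and the coefficients of the input-output
    equations are linear combinations of balanced products, by Leibniz'
    expansion of the determinants ([balanced_span_coefs]).

    The balanced products generate an algebra of transcendence degree at most
    d := |E| + |In U Out|: since G is connected, there is a forest of
    |V| - |In U Out| edges such that the exponents of a balanced product on the
    remaining d arcs (among the edges and the |V| loops) determine it
    ([exists_spanning_forest]).  So, up to degree K, there are at most
    (K + 1)^d balanced products ([balanced_span_growth]), whereas d + 1
    algebraically independent elements would have of the order of K^(d + 1)
    independent monomials ([exists_algebraic_relation]).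

    If the image of the coefficient map has dimension d, the coefficients
    generate a subalgebra of transcendence degree d already: elements p_i
    of P_(i+1) \ P_i along a chain P_0 < ... < P_d of primes are algebraically
    independent modulo P_0 ([ideal_chain_indep]).  Hence a cycle or path monomial
    f satisfies a nontrivial algebraic equation over the coefficients, and the
    real roots of that equation are a finite list of candidates for f
    ([locally_identifiable_algebraic]).  Every parameter lies in a cycle or path
    by the connectedness hypothesis. *)

Set Implicit Arguments.
Unset Strict Implicit.
Unset Printing Implicit Defensive.

Import GRing.Theory.
Local Open Scope ring_scope.

(** * Algebraic independence, growth and chains of primes *)

Section Algebra.
Variables (F : fieldType) (A : comAlgType F).

(** More vectors than there are elements in a spanning family are dependent. *)
Lemma exists_linear_relation (X T : finType) (v : X -> A) (g : T -> A) :
    (#|T| < #|X|)%N ->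
    (forall x, exists co : T -> F, v x = \sum_t co t *: g t) ->
  exists2 u : X -> F, exists x, u x != 0 & \sum_x u x *: v x = 0.
Proof.
move=> ltTX /fin_all_exists[co vE].
pose B := \matrix_(i < #|X|, j < #|T|) co (enum_val i) (enum_val j).
have : kermx B != 0.
  by rewrite -mxrank_eq0 mxrank_ker subn_eq0 -ltnNge (leq_ltn_trans (rank_leq_col B)).
case/rowV0Pn=> w /sub_kermxP wB0 /rV0Pn[i wi0].
exists (fun x => w 0 (enum_rank x)).
  by exists (enum_val i); rewrite enum_valK.
under eq_bigr do rewrite vE scaler_sumr.
rewrite exchange_big /= big1 // => t _.
transitivity ((\sum_x w 0 (enum_rank x) * co x t) *: g t).
  by rewrite scaler_suml; apply: eq_bigr => x _; rewrite scalerA.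
have /matrixP/(_ 0 (enum_rank t)) := wB0; rewrite !mxE.
rewrite (reindex enum_rank) /=; last by apply: onW_bij; apply: enum_rank_bij.
under eq_bigr do rewrite mxE !enum_rankK.
by move=> ->; rewrite scale0r.
Qed.

(** Algebraic independence over F of b_0, ..., b_(d-1).  A polynomial is given by
    its coefficients u on the box of exponents smaller than some N, rather than
    as a multivariate polynomial. *)
Definition alg_indep d (b : 'I_d -> A) : Prop :=
  forall N (u : {ffun 'I_d -> 'I_N} -> F),
    \sum_m u m *: \prod_i b i ^+ m i = 0 -> forall m, u m = 0.

(** If the monomials of degree less than N in each of d + 1 elements b_i and f
    all lie in the span of (N D + 1)^d elements, then b_i and f satisfy a
    nontrivial algebraic relation, written as a polynomial in f. *)
Lemma exists_algebraic_relation d D (b : 'I_d -> A) (f : A) :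
    (forall N, exists (T : finType) (g : T -> A), (#|T| <= (N * D).+1 ^ d)%N /\
       forall (m : {ffun 'I_d -> 'I_N}) (t : 'I_N), exists co : T -> F,
         (\prod_i b i ^+ m i) * f ^+ t = \sum_x co x *: g x) ->
  exists N (u : {ffun 'I_d -> 'I_N} -> 'I_N -> F),
    (exists m t, u m t != 0) /\
    \sum_t (\sum_m u m t *: \prod_i b i ^+ m i) * f ^+ t = 0.
Proof.
move=> growth.
(* (N D + 1)^d <= N^d (D + 1)^d, which is smaller than N^(d + 1) as soon as N
   exceeds (D + 1)^d. *)
pose N := (D.+1 ^ d).+1.
have [T [g [cardT gE]]] := growth N.
pose v (x : {ffun 'I_d -> 'I_N} * 'I_N) := (\prod_i b i ^+ x.1 i) * f ^+ x.2.
have ltTX : (#|T| < #|{: {ffun 'I_d -> 'I_N} * 'I_N}|)%N.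
  rewrite card_prod card_ffun !card_ord (leq_ltn_trans cardT) //.
  apply: (@leq_ltn_trans (N ^ d * D.+1 ^ d)%N).
    rewrite -expnMn; case: (posnP d) => [->//|d0].
    by rewrite leq_exp2r // mulnS /N; lia.
  by rewrite ltn_pmul2l ?expn_gt0.
have [|u [[m t] umt] u0] := exists_linear_relation ltTX (v := v) (g := g).
  by case=> m t; apply: gE.
exists N, (fun m t => u (m, t)); split; first by exists m, t.
rewrite -[RHS]u0; under eq_bigr do rewrite mulr_suml.
rewrite exchange_big pair_bigA /=; apply: eq_bigr => -[m' t'] _ /=.
by rewrite scalerAl.
Qed.

(** Elements p_i of P_(i+1) \ P_i, for an increasing sequence of prime ideals P_i,
    are algebraically independent modulo P_0.  The proof isolates the
    lexicographically least exponent of a relation: once the least power of p_i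
    is factored out, as P_i is prime, the remaining terms divisible by p_i are
    dropped in passing to P_(i+1). *)
Lemma ideal_chain_indep d (P : nat -> {pred A}) (p : 'I_d -> A) :
    (forall i, idealr_closed (P i) /\ prime_idealr_closed (P i)) ->
    (forall i, {subset P i <= P i.+1}) ->
    (forall i : 'I_d, p i \in P i.+1 /\ p i \notin P i) ->
  forall N (u : {ffun 'I_d -> 'I_N} -> F),
    \sum_m u m *: \prod_i p i ^+ m i \in P 0%N -> forall m, u m = 0.
Proof.
move=> idealP subP pP N u u0 m; apply/eqP; apply: contraT => um0.
have mulP i a x : x \in P i -> a * x \in P i.
  by have [[P0 _ Pl] _] := idealP i => Px; rewrite -[_ * _]addr0 Pl.
have addP i x y : x \in P i -> y \in P i -> x + y \in P i.
  by have [[_ _ Pl] _] := idealP i => Px Py; rewrite -[x]mul1r Pl.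
have eqmem i x y : x = y -> x \in P i -> y \in P i by move=> ->.
(* S is the set of the exponents of the relation whose first i coordinates are
   lexicographically least. *)
have step i : (i <= d)%N -> exists S : {set {ffun 'I_d -> 'I_N}},
    [/\ S != set0, {in S, forall m', u m' != 0},
        forall m1 m2, m1 \in S -> m2 \in S ->
          forall j : 'I_d, (j < i)%N -> m1 j = m2 j
      & \sum_(m' in S) u m' *: \prod_(j < d | (i <= j)%N) p j ^+ m' j \in P i].
  elim: i => [_|i IH ltid].
    exists [set m' | u m' != 0]; split=> //.
    - by apply/set0Pn; exists m; rewrite inE.
    - by move=> m'; rewrite inE.
    rewrite big_mkcond /=; apply: eqmem u0; apply: eq_bigr => m' _.
    rewrite inE; case: eqVneq => // ->.
    by rewrite scale0r.
  have [S [S0 uS eqS sumS]] := IH (ltnW ltid).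
  have [m0 m0S] := set0Pn _ S0.
  pose o := Ordinal ltid.
  have [m1 /= m1S m1min] :=
    @arg_minnP _ m0 (fun m' => m' \in S)
      (fun m' : {ffun 'I_d -> 'I_N} => m' o : nat) m0S.
  pose t : nat := m1 o.
  exists [set m' in S | m' o == m1 o]; split.
  - by apply/set0Pn; exists m1; rewrite inE m1S eqxx.
  - by move=> m'; rewrite inE => /andP[/uS].
  - move=> m2 m3 /[!inE] /andP[m2S /eqP m2o] /andP[m3S /eqP m3o] j.
    rewrite ltnS leq_eqVlt => /orP[/eqP ji|]; last exact: eqS.
    by have -> : j = o; [apply: val_inj | rewrite m2o].
  have prodE (m' : {ffun 'I_d -> 'I_N}) : m' \in S ->
      \prod_(j < d | (i <= j)%N) p j ^+ m' j = p o ^+ t *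
         (p o ^+ (m' o - t) * \prod_(j < d | (i.+1 <= j)%N) p j ^+ m' j).
    move=> m'S; rewrite mulrA -exprD subnKC ?m1min // (bigD1 o) /=; last exact: leqnn.
    congr (_ * _); apply: eq_bigl => j; rewrite [RHS]ltn_neqAle andbC.
    by rewrite -val_eqE /= eq_sym.
  set s := (X in X \in _).
  have: p o ^+ t * (s + p o * \sum_(m' in S | m' o != m1 o)
      u m' *: (p o ^+ (m' o - t).-1 * \prod_(j < d | (i < j)%N) p j ^+ m' j)) \in P i.
    apply: eqmem sumS.
    rewrite (bigID (fun m' : {ffun 'I_d -> 'I_N} => m' o == m1 o)) /= mulrDr.
    rewrite /s; congr (_ + _).
      rewrite mulr_sumr; under [RHS]eq_bigl do rewrite inE.
      apply: eq_bigr => m' /andP[m'S /eqP m'o].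
      by rewrite prodE // m'o subnn mul1r scalerAr.
    rewrite mulr_sumr mulr_sumr; apply: eq_bigr => m' /andP[m'S m'o].
    rewrite prodE // -!scalerAr; congr (_ *: (_ * _)).
    rewrite mulrA -exprS prednK // subn_gt0 ltn_neqAle m1min // andbT.
    by rewrite eq_sym.
  have [po' po] := pP o.
  have [_ primeP] := idealP i.
  have powP k : p o ^+ k \notin P i.
    elim: k => [|k IHk]; first by have [[_ ? _] _] := idealP i.
    by rewrite exprS; apply/negP=> /primeP/orP[]; apply/negP.
  move/primeP/orP=> [/(negP (powP t))//|/subP].
  set r := _ * \sum_(_ | _ && _) _ => sr.
  have -> : s = -1 * r + (s + r) by rewrite mulN1r addrC addrK.
  by apply: addP; rewrite // /r mulP // mulrC mulP.
have [S [S0 uS eqS sumS]] := step d (leqnn d).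
have [m1 m1S] := set0Pn _ S0.
have SE : S = [set m1].
  apply/setP=> m'; rewrite inE; apply/idP/eqP => [m'S|->//].
  by apply/ffunP=> j; apply: eqS.
move: sumS; rewrite SE big_set1 big_pred0; last by move=> j; rewrite leqNgt ltn_ord.
have [[_ /negP P1 _] _] := idealP d.
move=> /(mulP _ ((u m1)^-1)%:A).
by rewrite -scalerAl mul1r scalerA mulVf ?scale1r ?uS.
Qed.

End Algebra.

(** A set S whose coordinate ring has a chain of primes of length d carries d
    polynomials that are algebraically independent as functions on S. *)
Lemma prime_chain_indep (R : realType) k (S : ('I_k -> R) -> Prop) d :
    prime_chain S d ->
  exists p : 'I_d -> {mpoly R[k]}, forall N (u : {ffun 'I_d -> 'I_N} -> R),
    vanishes_on S (\sum_m u m *: \prod_i p i ^+ m i) -> forall m, u m = 0.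
Proof.
case=> P [idealP vanP chainP].
(* The chain is extended to all indices by repeating its last ideal. *)
pose P' (i : nat) := P (inord (minn i d)).
have /fin_all_exists[p pP] (i : 'I_d) :
    exists p, p \in P' i.+1 /\ p \notin P' i.
  have [|_ [p]] := chainP (inord (minn i d)) (inord (minn i.+1 d)).
    by rewrite !inordK; have := ltn_ord i; lia.
  by exists p.
exists p => N u /vanP u0; apply: (ideal_chain_indep (P := P') _ _ pP).
- by move=> i; apply: idealP.
- move=> i; rewrite /P'; have [ltid|ledi] := ltnP i d.
    apply: (proj1 (chainP _ _ _)).
    by rewrite !inordK; lia.
  by have -> : minn i.+1 d = d by lia.
- by have := u0 (inord (minn 0 d)).
Qed.

Lemma comp_mpoly_sum (R : comNzRingType) q k d N (c : k.-tuple {mpoly R[q]})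
    (p : 'I_d -> {mpoly R[k]}) (u : {ffun 'I_d -> 'I_N} -> R) :
  (\sum_m u m *: \prod_i p i ^+ m i) \mPo c =
  \sum_m u m *: \prod_i (p i \mPo c) ^+ m i.
Proof.
rewrite (raddf_sum (comp_mpoly c)); apply: eq_bigr => m _ /=.
rewrite comp_mpolyZ rmorph_prod /=; congr (_ *: _).
by apply: eq_bigr => i _; rewrite rmorphXn.
Qed.

(** * Algebraic functions of the coefficients are locally identifiable *)

Section LocalIdentifiability.
Variables (R : realType) (n : nat) (M : model n).
Local Notation pring := {mpoly R[nparam M]}.

(** The coefficient map as a tuple of polynomials in the parameters. *)
Definition coef_tuple := [tuple nth 0 (coefs R M) l | l < size (coefs R M)].

Lemma comp_coef_tupleE p theta :
  (p \mPo coef_tuple).@[theta] = p.@[coefficient_map (M := M) theta].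
Proof.
rewrite comp_mpoly_meval; apply: meval_eq => l.
by rewrite tnth_mktuple.
Qed.

(** If the image of the coefficient map has dimension d, then some d polynomials
    in the coefficients are algebraically independent polynomials in the
    parameters. *)
Lemma image_dimension_indep d :
    has_dimension (@coefficient_image R n M) d ->
  exists p : 'I_d -> {mpoly R[size (coefs R M)]},
    alg_indep (fun i => p i \mPo coef_tuple).
Proof.
case=> /prime_chain_indep[p pP] _; exists p => N u u0.
apply: pP => y [theta ->].
rewrite -comp_coef_tupleE comp_mpoly_sum.
by rewrite [X in X.@[theta]]u0 meval0.
Qed.

(** A polynomial f in the parameters that is algebraic over algebraically
    independent polynomials in the coefficients is locally identifiable. *)
Lemma locally_identifiable_algebraic d
    (p : 'I_d -> {mpoly R[size (coefs R M)]}) (f : pring) N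
    (u : {ffun 'I_d -> 'I_N} -> 'I_N -> R) :
    let b i := p i \mPo coef_tuple in
    alg_indep b -> (exists m t, u m t != 0) ->
    \sum_t (\sum_m u m t *: \prod_i b i ^+ m i) * f ^+ t = 0 ->
  locally_identifiable (fun theta => f.@[theta]).
Proof.
move=> b indep [m0 [t0 um0]] rel.
pose Q t := \sum_m u m t *: \prod_i p i ^+ m i.
have QE t : Q t \mPo coef_tuple = \sum_m u m t *: \prod_i b i ^+ m i.
  exact: comp_mpoly_sum.
(* The candidates at y are the real roots of the relation at y, and theta is
   generic when the coefficient of f ^+ t0 does not vanish at theta. *)
exists (fun y => rootsR (\sum_t ((Q t).@[y])%:P * 'X^t)).
exists (Q t0 \mPo coef_tuple).
  by apply: contra um0; rewrite QE => /eqP/indep->.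
move=> theta; rewrite comp_coef_tupleE => Qt0.
set y := coefficient_map theta in Qt0 *.
set q := \sum_t _.
have q0 : q != 0.
  apply: contra Qt0 => /eqP/(congr1 (fun r : {poly R} => r`_t0)).
  rewrite coef0 coef_sum (bigD1 t0) //= coefCM coefXn eqxx mulr1.
  rewrite big1 ?addr0 => [->//|t neq].
  by rewrite coefCM coefXn eq_sym val_eqE (negPf neq) mulr0.
have := roots_on_rootsR q0 (f.@[theta]); rewrite in_itv /= => <-.
apply/rootP; rewrite horner_sum -[RHS](meval0 theta) -rel raddf_sum /=.
apply: eq_bigr => t _.
by rewrite hornerM hornerC hornerXn mevalM rmorphXn /= -QE comp_coef_tupleE.
Qed.

End LocalIdentifiability.

(** * Boundaries of chains of arcs and spanning forests *)

Section Boundary.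
Variable n : nat.
Implicit Types (a : 'I_n * 'I_n) (s t : seq ('I_n * 'I_n)).
Implicit Types (v w : 'I_n) (p : seq 'I_n).

(** The boundary i - j of the arc (j, i), as an integral combination of
    vertices. *)
Definition arc_boundary a : 'rV[int]_n := delta_mx 0 a.2 - delta_mx 0 a.1.

(** The coordinate of v is the number of the arcs of s that enter v, minus the
    number of those that leave v. *)
Definition boundary s : 'rV[int]_n := \sum_(a <- s) arc_boundary a.

Lemma arc_boundaryE a v :
  arc_boundary a 0 v = (v == a.2)%:R - (v == a.1)%:R.
Proof. by rewrite !mxE. Qed.

Lemma boundary_cat s t : boundary (s ++ t) = boundary s + boundary t.
Proof. exact: big_cat. Qed.

Lemma boundary_count s :
  boundary s = \sum_a (count_mem a s)%:Z *: arc_boundary a.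
Proof.
elim: s => [|b s IH]; rewrite /boundary ?big_nil ?big_cons.
  by rewrite big1 // => a _; rewrite scale0r.
rewrite -/(boundary s) IH [RHS](bigD1 b) //= [in LHS](bigD1 b) //= addrA.
rewrite eqxx PoszD scalerDl scale1r; congr (_ + _).
by apply: eq_bigr => a; rewrite eq_sym => /negPf->.
Qed.

Lemma boundary_path v p :
  boundary (path_arcs (v :: p)) = delta_mx 0 (last v p) - delta_mx 0 v.
Proof.
rewrite /path_arcs /boundary /=.
elim: p v => [|w p IH] v /=; first by rewrite big_nil subrr.
by rewrite big_cons IH /arc_boundary /= addrC addrA subrK.
Qed.

(** A cycle is the path which goes through its vertices and back to the first
    one. *)
Lemma cycle_arcsE v p : cycle_arcs (v :: p) = path_arcs (v :: rcons p v).
Proof.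
rewrite /cycle_arcs /path_arcs /= rot1_cons.
by elim: p {1 3}v => [//|w p IH] x /=; rewrite IH.
Qed.

Lemma all_path_arcs (r : rel 'I_n) v p :
  all (fun a => r a.1 a.2) (path_arcs (v :: p)) = path r v p.
Proof.
rewrite /path_arcs /=.
by elim: p v => [//|w p IH] v /=; rewrite IH.
Qed.

Lemma mem_last_path_arcs v p w : (last v p, w) \in path_arcs (v :: rcons p w).
Proof.
rewrite /path_arcs /=.
elim: p v => [|x p IH] v /=; first by rewrite inE.
by rewrite inE IH orbT.
Qed.

(** In a connected graph, contracting S to a point and taking a spanning tree
    yields |V| - |S| edges Fo, such that no nonzero integral chain z supported on
    Fo has its boundary supported on S.  The proof is by induction on the
    complement of S: an edge a0 that joins S to a vertex v outside S is added to
    a forest for S and v, and z vanishes at a0 since its boundary vanishes at v. *)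
Lemma exists_spanning_forest (e : rel 'I_n) (S : {set 'I_n}) :
    S != set0 -> (forall u v, connect [rel x y | e x y || e y x] u v) ->
  exists Fo : {set 'I_n * 'I_n},
    [/\ {in Fo, forall a, e a.1 a.2}, #|Fo| = #|~: S|
      & forall z : 'I_n * 'I_n -> int, (forall a, a \notin Fo -> z a = 0) ->
        (forall v, v \notin S -> (\sum_a z a *: arc_boundary a) 0 v = 0) ->
        forall a, z a = 0].
Proof.
move=> S0 conn; move cardS: #|~: S| => k; elim: k S S0 cardS => [|k IH] S S0 cardS.
  exists set0; split=> [a||z z0 _ a]; [by rewrite inE|by rewrite cards0|].
  by rewrite z0 ?inE.
have [x [v [xS vS exv]]] :
    exists x, exists v, [/\ x \in S, v \notin S & e x v || e v x].
  have [w wS] := set0Pn _ S0.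
  have [v vS] : exists v, v \in ~: S by apply/card_gt0P; rewrite cardS.
  apply: contrapT => none; move: vS; rewrite inE => /negP; apply.
  have cl : closed [rel x y | e x y || e y x] (mem S).
    move=> x y /= exy; apply/idP/idP => hS; apply: contrapT => /negP nS.
      by apply: none; exists x, y.
    by apply: none; exists y, x; rewrite orbC.
  by rewrite -(closed_connect cl (conn w v)).
have vx : v != x by apply: contraNneq vS => ->.
have [a0 [ea0 a0v a0w]] : exists a0, [/\ e a0.1 a0.2, arc_boundary a0 0 v != 0
    & forall w, w \notin v |: S -> arc_boundary a0 0 w = 0].
  have w0 w : w \notin v |: S -> (w == x = false) * (w == v = false).
    rewrite !inE negb_or => /andP[/negPf -> wS]; split=> //.
    by apply: contraNF wS => /eqP->.
  case/orP: exv => exv; [exists (x, v)|exists (v, x)]; split=> //.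
  - by rewrite arc_boundaryE /= eqxx (negPf vx).
  - by move=> w /w0 w0'; rewrite arc_boundaryE /= !w0'.
  - by rewrite arc_boundaryE /= eqxx (negPf vx).
  - by move=> w /w0 w0'; rewrite arc_boundaryE /= !w0'.
have [||Fo [eFo cardFo zFo]] := IH (v |: S).
- by apply/set0Pn; exists v; rewrite setU11.
- apply: (@addnI #|v |: S|).
  by rewrite cardsC -(cardsC S) cardS cardsU1 vS add1n addSnnS.
(* Otherwise a0 itself, whose boundary is supported on S and v, would be a
   counterexample for Fo. *)
have a0Fo : a0 \notin Fo.
  apply/negP=> a0Fo; suff : (a0 == a0)%:R = 0 :> int by rewrite eqxx.
  apply: (zFo (fun a => (a == a0)%:R)) => [a aFo|w wS].
    by case: eqVneq aFo => // ->; rewrite a0Fo.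
  rewrite (bigD1 a0) //= eqxx scale1r big1 => [|a /negPf->]; last exact: scale0r.
  by rewrite addr0 a0w.
exists (a0 |: Fo); split.
- by move=> a; rewrite !inE => /orP[/eqP->|/eFo].
- by rewrite cardsU1 a0Fo cardFo.
move=> z z0 bz.
have zE : forall a, (a != a0)%:R * z a = 0.
  apply: zFo => [a aFo|w wS].
    by case: eqVneq => [->|aa0]; rewrite ?mul0r // z0 ?mulr0 // !inE negb_or aa0.
  rewrite -[RHS](bz w); last by apply: contra wS; rewrite !inE orbC => ->.
  rewrite [in RHS](bigD1 a0) //= mxE mxE a0w // mulr0 add0r.
  rewrite (bigD1 a0) //= eqxx mul0r scale0r add0r.
  by congr (fun_of_matrix _ _ _); apply: eq_bigr => a ->; rewrite mul1r.
have za a : a != a0 -> z a = 0 by move=> aa0; have := zE a; rewrite aa0 mul1r.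
move=> a; have [->|/za//] := eqVneq a a0.
have /eqP := bz v vS; rewrite (bigD1 a0) //= big1; last first.
  by move=> b /za->; rewrite scale0r.
by rewrite addr0 mxE mulf_eq0 (negPf a0v) orbF => /eqP.
Qed.

End Boundary.

(** * The grading of polynomials by boundaries *)

Section MonomialSpan.
Variables (R : realType) (n : nat) (M : model n).
Local Notation pring := {mpoly R[nparam M]}.
Local Notation arc := ('I_n * 'I_n)%type.
Local Notation monomial := (monomial R M).
Implicit Types (P Q T : seq arc -> Prop) (x y : pring).

(** The span of the monomials of the sequences of arcs that satisfy P. *)
Inductive monspan P : pring -> Prop :=
| Monspan0 : monspan P 0
| MonspanD c s x : P s -> monspan P x -> monspan P (c *: monomial s + x).

Lemma monomial_cat s t : monomial (s ++ t) = monomial s * monomial t.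
Proof. exact: big_cat. Qed.

Lemma monspanS P Q x : (forall s, P s -> Q s) -> monspan P x -> monspan Q x.
Proof.
by move=> PQ; elim=> [|c s y /PQ Qs _ Qy]; [apply: Monspan0|apply: MonspanD].
Qed.

Lemma monspanD P x y : monspan P x -> monspan P y -> monspan P (x + y).
Proof.
move=> Px Py; elim: Px => [|c s z Ps _ IH]; first by rewrite add0r.
by rewrite -addrA; apply: MonspanD.
Qed.

Lemma monspanZ P c x : monspan P x -> monspan P (c *: x).
Proof.
elim=> [|c' s z Ps _ IH]; first by rewrite scaler0; apply: Monspan0.
by rewrite scalerDr scalerA; apply: MonspanD.
Qed.

Lemma monspanN P x : monspan P x -> monspan P (- x).
Proof. by rewrite -scaleN1r; apply: monspanZ. Qed.

Lemma monspan_monomial P s : P s -> monspan P (monomial s).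
Proof.
move=> Ps; rewrite -[monomial s]scale1r -[_ *: _]addr0.
by apply: MonspanD => //; apply: Monspan0.
Qed.

Lemma monspan_sum P (I : Type) (r : seq I) (p : pred I) (F : I -> pring) :
  (forall i, p i -> monspan P (F i)) -> monspan P (\sum_(i <- r | p i) F i).
Proof. by move=> PF; apply: big_ind => //; [apply: Monspan0|apply: monspanD]. Qed.

Lemma monspanM P Q T x y : (forall s t, P s -> Q t -> T (s ++ t)) ->
  monspan P x -> monspan Q y -> monspan T (x * y).
Proof.
move=> PQT Px Qy; elim: Px => [|c s x' Ps _ IHx].
  by rewrite mul0r; apply: Monspan0.
rewrite mulrDl; apply: monspanD => {IHx x'}//; rewrite -scalerAl.
apply: monspanZ; elim: Qy => [|d t y' Qt _ IHy].
  by rewrite mulr0; apply: Monspan0.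
rewrite mulrDr -scalerAr -monomial_cat; apply: monspanD => //.
by apply/monspanZ/monspan_monomial/PQT.
Qed.

(** The arcs at which A may be nonzero: the edges, and a loop at each vertex. *)
Definition is_arc a := (a.1 == a.2) || edge M a.1 a.2.

(** The polynomials of degree b, for the grading in which the entry of A at an arc
    has degree the boundary of that arc. *)
Definition graded (b : 'rV[int]_n) : pring -> Prop :=
  monspan (fun s => all is_arc s /\ boundary s = b).

(** The indeterminate has degree 0. *)
Definition graded_poly b (p : {poly pring}) := forall k, graded b p`_k.

Lemma graded1 : graded 0 1.
Proof.
rewrite -(_ : monomial [::] = 1); last exact: big_nil.
by apply: monspan_monomial; rewrite /boundary big_nil.
Qed.

Lemma gradedM b c x y : graded b x -> graded c y -> graded (b + c) (x * y).
Proof.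
apply: monspanM => s t [sa <-] [ta <-].
by rewrite all_cat sa ta boundary_cat.
Qed.

Lemma compartmental_matrix_eq0 i j :
  ~~ is_arc (j, i) -> compartmental_matrix R M i j = 0.
Proof.
rewrite /is_arc negb_or mxE eq_sym /= => /andP[/negPf-> Nji].
by rewrite /par insubN.
Qed.

Lemma graded_entry i j : graded (arc_boundary (j, i)) (compartmental_matrix R M i j).
Proof.
have [ji|/compartmental_matrix_eq0->] := boolP (is_arc (j, i)); last exact: Monspan0.
rewrite -(_ : monomial [:: (j, i)] = compartmental_matrix R M i j); last first.
  exact: big_seq1.
by apply: monspan_monomial; rewrite /= ji /boundary big_seq1.
Qed.

(** The indeterminate only occurs on the diagonal, where the boundary is 0. *)
Lemma graded_char_poly_mx i j :
  graded_poly (arc_boundary (j, i)) (char_poly_mx (compartmental_matrix R M) i j).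
Proof.
have := graded_entry i j; move: (compartmental_matrix R M) => B hB k.
rewrite !mxE coefB coefMn coefX coefC.
apply: monspanD; last first.
  by apply: monspanN; case: ifP => // _; apply: Monspan0.
case: (eqVneq i j) => [->|_]; last exact: Monspan0.
by rewrite /arc_boundary subrr; case: (k == 1)%N; [apply: graded1|apply: Monspan0].
Qed.

Lemma graded_poly1 : graded_poly 0 1.
Proof.
by move=> k; rewrite coef1; case: (k == 0)%N; [apply: graded1|apply: Monspan0].
Qed.

Lemma graded_polyM b c p q :
  graded_poly b p -> graded_poly c q -> graded_poly (b + c) (p * q).
Proof.
by move=> hp hq k; rewrite coefM; apply: monspan_sum => i _; apply: gradedM.
Qed.

Lemma graded_poly_prod (I : Type) (r : seq I) (P : pred I) b
    (p : I -> {poly pring}) :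
  (forall i, graded_poly (b i) (p i)) ->
  graded_poly (\sum_(i <- r | P i) b i) (\prod_(i <- r | P i) p i).
Proof.
move=> hp; apply: big_ind2 => //; first exact: graded_poly1.
by move=> *; apply: graded_polyM.
Qed.

Lemma graded_poly_sign_sum (I : Type) (r : seq I) (P : pred I) b (e : I -> bool)
    (p : I -> {poly pring}) :
  (forall i, P i -> graded_poly b (p i)) ->
  graded_poly b (\sum_(i <- r | P i) (-1) ^+ e i * p i).
Proof.
move=> hp k; rewrite coef_sum; apply: monspan_sum => i Pi; rewrite mulr_sign.
by case: (e i); rewrite ?coefN; [apply: monspanN|]; apply: hp.
Qed.

(** The arcs of a permutation form disjoint cycles. *)
Lemma sum_arc_boundary_perm (s : 'S_n) : \sum_i arc_boundary (s i, i) = 0.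
Proof.
rewrite /arc_boundary /= sumrB [X in X - _](reindex_inj (@perm_inj _ s)) /=.
by rewrite subrr.
Qed.

Lemma graded_char_poly : graded_poly 0 (char_poly (compartmental_matrix R M)).
Proof.
apply: graded_poly_sign_sum => s _; rewrite -(sum_arc_boundary_perm s).
by apply: graded_poly_prod => i; apply: graded_char_poly_mx.
Qed.

(** Each term of the expansion of the cofactor comes from a permutation that maps i
    to j; without the arc (j, i), its cycles have the boundary of a path from i
    to j. *)
Lemma graded_cofactor i j : graded_poly (arc_boundary (i, j))
  (cofactor (char_poly_mx (compartmental_matrix R M)) i j).
Proof.
rewrite expand_cofactor; apply: graded_poly_sign_sum => s /eqP sij.
have -> : arc_boundary (i, j) = \sum_(k | i != k) arc_boundary (s k, k).
  have := sum_arc_boundary_perm s; rewrite (bigD1 i) //= sij => /eqP.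
  rewrite addr_eq0 => /eqP/(congr1 -%R); rewrite opprK => arcE.
  transitivity (- arc_boundary (j, i)); first by rewrite /arc_boundary opprB.
  by rewrite arcE; apply: eq_bigl => k; rewrite eq_sym.
by apply: graded_poly_prod => k; apply: graded_char_poly_mx.
Qed.

(** * Balanced products *)

Local Notation ports := (inp M :|: outp M).

(** The arcs of s are edges or loops, and the boundary of s is supported on the
    inputs and outputs. *)
Definition balanced s : Prop :=
  all is_arc s /\ forall v, v \notin ports -> boundary s 0 v = 0.

(** This is the algebra generated by the cycles and input-output paths, together
    with paths between any two inputs or outputs. *)
Definition balanced_span : pring -> Prop := monspan balanced.

(** Combinations of balanced products of at most K entries of A. *)
Definition balanced_span_le K : pring -> Prop :=
  monspan (fun s => balanced s /\ (size s <= K)%N).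

Lemma balanced_cat s t : balanced s -> balanced t -> balanced (s ++ t).
Proof.
move=> [sa sb] [ta tb]; split=> [|v vp]; first by rewrite all_cat sa ta.
by rewrite boundary_cat mxE sb ?tb.
Qed.

Lemma graded_balanced_span (b : 'rV[int]_n) x :
  (forall v, v \notin ports -> b 0 v = 0) -> graded b x -> balanced_span x.
Proof. by move=> b0; apply: monspanS => s [sa sb]; rewrite /balanced sb. Qed.

Lemma arc_boundary_ports i j v :
  i \in ports -> j \in ports -> v \notin ports -> arc_boundary (i, j) 0 v = 0.
Proof.
move=> ip jp vp; rewrite arc_boundaryE /=.
have /negPf-> : v != j by apply: contraNneq vp => ->.
by have /negPf-> : v != i by apply: contraNneq vp => ->.
Qed.

Lemma balanced_span_coefs l : balanced_span (coefs R M)`_l.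
Proof.
have [lt_l|le_l] := ltnP l (size (coefs R M)); last first.
  by rewrite nth_default //; apply: Monspan0.
have := mem_nth 0 lt_l; rewrite mem_filter => /andP[_ /flatten_mapP[j]].
rewrite mem_enum mem_cat => jO /orP[|/flatten_mapP[i]].
  move=> /(nthP 0)[k _ <-]; apply: graded_balanced_span (graded_char_poly k) => v _.
  by rewrite mxE.
rewrite mem_enum => iI /(nthP 0)[k _ <-].
apply: graded_balanced_span (graded_cofactor i j k) => v vp.
by rewrite arc_boundary_ports // inE ?iI ?jO ?orbT.
Qed.

Lemma balanced_span1 : balanced_span 1.
Proof. by apply: graded_balanced_span graded1 => v _; rewrite mxE. Qed.

Lemma balanced_spanM x y :
  balanced_span x -> balanced_span y -> balanced_span (x * y).
Proof. exact/monspanM/balanced_cat. Qed.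

Lemma balanced_span_comp p : balanced_span (p \mPo coef_tuple R M).
Proof.
rewrite comp_mpolyEX; apply: monspan_sum => m _; apply: monspanZ.
rewrite comp_mpolyX; apply: big_ind; [exact: balanced_span1|exact: balanced_spanM|].
move=> i _; rewrite tnth_mktuple; elim: (m i) => [|k IH]; first exact: balanced_span1.
by rewrite exprS; apply: balanced_spanM => //; apply: balanced_span_coefs.
Qed.

Lemma balanced_span_leP x : balanced_span x -> exists K, balanced_span_le K x.
Proof.
elim=> [|c s y bs _ [K IH]]; first by exists 0%N; apply: Monspan0.
exists (maxn (size s) K); apply: MonspanD; first by rewrite leq_maxl.
by apply: monspanS IH => t [bt leK]; rewrite leq_max leK orbT.
Qed.

Lemma balanced_span_leW K L x :
  (K <= L)%N -> balanced_span_le K x -> balanced_span_le L x.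
Proof. by move=> KL; apply: monspanS => t [bt /leq_trans->]. Qed.

Lemma balanced_span_leM K L x y :
  balanced_span_le K x -> balanced_span_le L y -> balanced_span_le (K + L) (x * y).
Proof.
apply: monspanM => s t [sb sK] [tb tL].
by split; [apply: balanced_cat|rewrite size_cat leq_add].
Qed.

Lemma balanced_span_le1 : balanced_span_le 0 1.
Proof.
rewrite -(_ : monomial [::] = 1); last exact: big_nil.
apply: monspan_monomial; split=> //; split=> // v _.
by rewrite /boundary big_nil mxE.
Qed.

Lemma balanced_span_leX K x k :
  balanced_span_le K x -> balanced_span_le (k * K) (x ^+ k).
Proof.
move=> Kx; elim: k => [|k IH]; first exact: balanced_span_le1.
by rewrite exprS mulSn; apply: balanced_span_leM.
Qed.

Lemma balanced_span_le_prod (I : Type) (r : seq I) (K : I -> nat) (F : I -> pring) :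
  (forall i, balanced_span_le (K i) (F i)) ->
  balanced_span_le (\sum_(i <- r) K i) (\prod_(i <- r) F i).
Proof.
move=> KF; apply: big_ind2 => //; first exact: balanced_span_le1.
by move=> *; apply: balanced_span_leM.
Qed.

Lemma card_is_arc : #|[set a | is_arc a]| = (num_edges M + n)%N.
Proof.
have -> : [set a | is_arc a] =
    [set a | edge M a.1 a.2] :|: [set (i, i) | i in 'I_n].
  apply/setP=> -[j i]; rewrite !inE orbC; congr orb.
  apply/eqP/imsetP=> /= [->|[k _ [-> ->]]//]; by exists i.
rewrite cardsU card_imset ?card_ord; last by move=> i j [].
rewrite (_ : _ :&: _ = set0) ?cards0 ?subn0 //.
apply/setP=> -[j i]; rewrite !inE; apply/negP=> /andP[/= ji].
by case/imsetP=> k _ [jk ik]; rewrite jk ik edge_irrefl in ji.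
Qed.

(** Balanced products of at most K entries are determined by their exponents,
    between 0 and K, on the |E| + |In U Out| arcs outside a spanning forest. *)
Lemma balanced_span_growth K : weakly_connected M ->
  exists (T : finType) (g : T -> pring),
    #|T| = (K.+1 ^ (num_edges M + #|ports|))%N /\
    forall x, balanced_span_le K x -> exists co : T -> R, x = \sum_t co t *: g t.
Proof.
move=> conn.
have ports0 : ports != set0.
  by rewrite setU_eq0 negb_and inp_neq0.
have [Fo [eFo cardFo zFo]] := exists_spanning_forest ports0 conn.
pose U := [set a | is_arc a] :\: Fo.
have cardU : #|U| = (num_edges M + #|ports|)%N.
  rewrite cardsD card_is_arc (setIidPr _).
    rewrite cardFo; have nE : n = (#|ports| + #|~: ports|)%N.
      by rewrite cardsC card_ord.
    by rewrite [X in (_ + X - _)%N]nE addnA addnK.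
  by apply/subsetP=> a /eFo; rewrite inE /is_arc orbC => ->.
pose T : finType := {ffun {a | a \in U} -> 'I_K.+1}.
pose sig s : T := [ffun a => inord (count_mem (val a) s)].
pose good s := balanced s /\ (size s <= K)%N.
have sigP s t : good s -> good t -> sig s = sig t -> monomial s = monomial t.
  move=> [[sa sb] sK] [[ta tb] tK] /ffunP sigst; apply: perm_big.
  apply/allP=> a _ /=; apply/eqP.
  (* The difference of the exponents is a chain on the forest, with boundary
     supported on the inputs and outputs. *)
  pose z a := (count_mem a s)%:Z - (count_mem a t)%:Z.
  suff /eqP : z a = 0 by rewrite subr_eq0 => /eqP[].
  move: a; apply: zFo => [a aFo|v vp]; last first.
    under eq_bigr do rewrite scalerBl.
    by rewrite sumrB -!boundary_count !mxE sb ?tb.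
  have [arca|arca] := boolP (is_arc a); last first.
    have nota r : all is_arc r -> count_mem a r = 0%N.
      by move=> /allP ra; apply/count_memPn/(contra (ra a)).
    by rewrite /z !nota.
  have aU : a \in U by rewrite !inE aFo.
  have := sigst (exist _ a aU); rewrite !ffunE /= => /(congr1 (@nat_of_ord _)).
  by rewrite /z !inordK ?ltnS ?(leq_trans (count_size _ _)) // => ->; rewrite subrr.
have /fin_all_exists[g gP] (f : T) :
    exists x, forall s, good s -> sig s = f -> monomial s = x.
  have [[s [gs sf]]|none] := pselect (exists s, good s /\ sig s = f).
    by exists (monomial s) => t gt tf; apply: sigP; rewrite ?tf.
  by exists 0 => s gs sf; case: none; exists s.
exists T, g; split.
  by rewrite card_ffun card_ord card_sig -cardU; congr (_ ^ _)%N; apply: eq_card.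
move=> x; elim=> [|c s y gs _ [co ->]].
  by exists (fun=> 0); rewrite big1 // => t _; rewrite scale0r.
exists (fun f => c *+ (f == sig s) + co f).
under [RHS]eq_bigr do rewrite scalerDl.
rewrite big_split /=; congr (_ + _).
rewrite (bigD1 (sig s)) //= eqxx big1 ?addr0; last first.
  by move=> f /negPf->; rewrite scale0r.
by rewrite (gP (sig s) s).
Qed.

(** If the coefficients have the largest possible transcendence degree among
    balanced polynomials, then each balanced polynomial is algebraic over them. *)
Lemma balanced_span_locally_identifiable f : weakly_connected M ->
    has_dimension (@coefficient_image R n M) (num_edges M + #|ports|) ->
    balanced_span f ->
  locally_identifiable (fun theta => f.@[theta]).
Proof.
move=> conn /image_dimension_indep[p indep] invf.
pose b i := p i \mPo coef_tuple R M.
have /fin_all_exists[K bK] i : exists K, balanced_span_le K (b i).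
  exact/balanced_span_leP/balanced_span_comp.
have [L fL] := balanced_span_leP invf.
(* A monomial of degree less than N in each of the b i and in f is a combination
   of balanced products of at most N D entries. *)
pose D := (\sum_i K i + L)%N.
have [N [u [u0 rel]]] : exists N (u : {ffun 'I__ -> 'I_N} -> 'I_N -> R),
    (exists m t, u m t != 0) /\
    \sum_t (\sum_m u m t *: \prod_i b i ^+ m i) * f ^+ t = 0.
  apply: (@exists_algebraic_relation _ _ _ D b f) => N.
  have [T [g [cardT gP]]] := balanced_span_growth (N * D) conn.
  exists T, g; split; first by rewrite cardT.
  move=> m t; apply: gP.
  apply: balanced_span_leW
    (balanced_span_leM (balanced_span_le_prod _ _) (balanced_span_leX t fL)).
    2: by move=> i; apply: balanced_span_leX (bK i).
  rewrite /D mulnDr big_distrr /= leq_add ?leq_mul ?(ltnW (ltn_ord _)) //.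
  by apply: leq_sum => i _; rewrite leq_mul ?(ltnW (ltn_ord _)).
exact: locally_identifiable_algebraic indep u0 rel.
Qed.

(** * Cycles and input-output paths *)

Lemma balanced_span_cycle s :
  graph_cycle M s || self_cycle s -> balanced_span (monomial (cycle_arcs s)).
Proof.
case: s => [|v p]; first by rewrite /graph_cycle /self_cycle.
move=> cyc; apply: monspan_monomial; rewrite cycle_arcsE; split.
  rewrite (all_path_arcs [rel j i | is_arc (j, i)]).
  case/orP: cyc => [/and3P[_ cyc _]|]; last first.
    by case: p => //= _; rewrite /is_arc eqxx.
  by apply: sub_path cyc => j i /= ji; rewrite /is_arc ji orbT.
by move=> w _; rewrite boundary_path last_rcons subrr mxE.
Qed.

Lemma balanced_span_path s : io_path M s -> balanced_span (monomial (path_arcs s)).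
Proof.
case: s => // v p /and4P[vp _ vI pO]; apply: monspan_monomial; split.
  rewrite (all_path_arcs [rel j i | is_arc (j, i)]).
  by apply: sub_path vp => j i /= ji; rewrite /is_arc ji orbT.
move=> w wp; rewrite boundary_path -[LHS]/(arc_boundary (v, last v p) 0 w).
by rewrite arc_boundary_ports // inE ?vI ?pO ?orbT.
Qed.

End MonomialSpan.

Lemma strongly_connected_weak n (M : model n) :
  strongly_connected M -> weakly_connected M.
Proof.
move=> conn u v; apply: connect_sub (conn u v) => x y xy.
by apply: connect1; rewrite /= xy.
Qed.

Lemma strongly_connected_cycle n (M : model n) j i :
    strongly_connected M -> edge M j i ->
  exists2 s, graph_cycle M s & (j, i) \in cycle_arcs s.
Proof.
move=> conn ji; have /connectP[p0 p0P jE] := conn i j.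
have {jE}[p ip [up jE]] :
    exists2 p, path (edge M) i p & uniq (i :: p) /\ j = last i p.
  by case: (shortenP p0P) jE => p ip up _ jE; exists p.
exists (i :: p); last by rewrite cycle_arcsE jE mem_last_path_arcs.
by rewrite /graph_cycle up andbT /= rcons_path ip -jE.
Qed.

Theorem theorem3p13 (R : realType) (n : nat) (M : model n)
    (hleak : leak M = [set: 'I_n])
    (hG : (strongly_io_connected M /\ #|outp M| = 1%N) \/
          (strongly_connected M /\ #|inp M| = 1%N))
    (hdim : has_dimension (@coefficient_image R n M)
              (num_edges M + #|inp M :|: outp M|)%N) :
  identifiable_path_cycle_model R M.
Proof.
have conn : weakly_connected M.
  by case: hG => [[[]]|[/strongly_connected_weak]].
split=> // [s cyc|s pth|j i].
- exact/(balanced_span_locally_identifiable conn hdim)/balanced_span_cycle.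
- exact/(balanced_span_locally_identifiable conn hdim)/balanced_span_path.
case/orP=> [/eqP->|ji].
  by left; exists [:: i]; rewrite ?orbT // inE.
case: hG => [[[_ cover] _]|[sc _]].
  have [[s sP sji]|] := cover j i ji; last by right.
  by left; exists s; rewrite ?sP.
by have [s sP sji] := strongly_connected_cycle sc ji; left; exists s; rewrite ?sP.
Qed.
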